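(* Let $n$ be a positive integer and $p$ a prime number. Let $f_n(x) = 1 + x + \frac{x^2}{2!} + \cdots + \frac{x^n}{n!}$, let $\theta$ be a root of $f_n(x)$, and let $K = \mathbb{Q}(\theta)$ with ring of algebraic integers $\mathbb{Z}_K$. Then $p$ does not divide the index $[\mathbb{Z}_K : \mathbb{Z}[\theta]]$ if and only if $p^2$ does not divide $n!$.
   Context: The polynomial $n!\, f_n(x) = x^n + n x^{n-1} + \frac{n!}{(n-2)!}x^{n-2} + \cdots + n!\,x + n!$ is monic with integer coefficients, so $\theta$ is an algebraic integer and $\mathbb{Z}[\theta]$ is a subgroup of finite index in $\mathbb{Z}_K$; $f_n(x)$ is irreducible over $\mathbb{Q}$, so $[K:\mathbb{Q}] = n$. *)

(* Defs.v *)
From HB Require Import structures.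
From mathcomp Require Export all_boot all_order all_algebra all_field.

Set Implicit Arguments.
Unset Strict Implicit.
Unset Printing Implicit Defensive.

Import GRing.Theory.
Local Open Scope ring_scope.

Definition exp_trunc (n : nat) : {poly rat} := \poly_(i < n.+1) (i`!%:R^-1).

Definition ring_of_integers (L : fieldExtType rat) (K : {subfield L}) (x : L) :
    Prop :=
  x \in K /\ integralOver (intr : int -> L) x.

Definition Zadjoin (L : fieldExtType rat) (theta x : L) : Prop :=
  exists q : {poly int}, x = (map_poly intr q).[theta].

(* For additive subgroups B <= A of V: [A : B] is finite, equal to N.  The
   family r is a complete system of representatives of the cosets of B in A,
   without repetition (apply the uniqueness to x := r i). *)
Definition has_index (V : zmodType) (A B : V -> Prop) (N : nat) : Prop :=
  (forall x, B x -> A x) /\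
  exists r : 'I_N -> V,
    (forall i, A (r i)) /\ (forall x, A x -> exists! i, B (x - r i)).

(* Main.v *)
(* Put [F = n! f_n], a monic integer polynomial, and [A = Z[theta]].

   [F] is irreducible (Coleman): the Newton polygon of [F] at a prime [q] has
   slopes [- (q^m - 1) / (q^m (q - 1))] only, so that every face of the polygon
   of a factor has length divisible by [q^m]; if [q^k] divides [n], only
   [m >= k] occur, hence [q^k] divides the degree of every factor.

   Since [F' = F - X^n], the conductor contains [F'(theta) = - theta^n], which
   divides [n!^n] in [A]; so the index is finite, and [p] divides it iff there
   is [y] in [Z_K] outside [A] with [p y] in [A].  If [p] does not divide [n!]
   there is no such [y].  If [n! = p u] with [u] prime to [p], we may assume
   [theta y] in [A] and, modulo [A], that [theta y] is an integer [a]; if [p | a]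
   the relation [F(theta) = 0] gives [u y] in [A], and otherwise [a / theta]
   cannot be integral because [F(0)] would divide a power of [a].  If [p^2]
   divides [n!], write [F = X^e g + p (X h + p c)] with [e = p (n / p)]: then
   [theta^(e-1) g(theta) / p] is integral, being a root of
   [X^2 + h(theta) X + c theta^(e-2) g(theta)]. *)

Require Import Defs.
From HB Require Import structures.
From mathcomp Require Import all_boot all_order all_algebra all_field.
From mathcomp Require Import all_fingroup all_solvable zify ring.
From Stdlib Require Import ClassicalEpsilon.

Set Implicit Arguments.
Unset Strict Implicit.
Unset Printing Implicit Defensive.

Import GRing.Theory Num.Theory.
Local Open Scope ring_scope.

(** * Newton polygons of integer polynomials *)

Section NewtonVertices.

Variables (p a b : nat).

(** The height [v_p(c) + (b / a) i] relative to lines of slope [- b / a], scaled by [a] to stay in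
    [nat]. It is meaningless at [c = 0], whence the nonvanishing conditions below. *)
Definition weight (c : int) (i : nat) : nat := (a * logn p `|c| + b * i)%N.

(* The nonzero coefficients of minimal weight span the face of slope [- b / a]
   of the Newton polygon of [P] at [p]; [side := ltn] selects the left end of
   this face and [side := gtn] its right end. *)
Definition newton_vertex (side : rel nat) (P : {poly int}) (mu i : nat) : Prop :=
  [/\ P`_i != 0, weight P`_i i = mu
    & forall j, P`_j != 0 ->
        (mu <= weight P`_j j)%N /\ (side j i -> (mu < weight P`_j j)%N)].

Lemma newton_vertex_inj (side : rel nat) P mu nu i j :
    (forall i j, i != j -> side i j || side j i) ->
    newton_vertex side P mu i -> newton_vertex side P nu j ->
  i = j.
Proof.
move=> side_total [nzi wi mini] [nzj wj minj]; apply/eqP/negPn/negP=> ne.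
have [h1 h2] := mini _ nzj; have [h3 h4] := minj _ nzi.
by case/orP: (side_total _ _ ne) => [/h4|/h2]; lia.
Qed.

Lemma newton_vertex_weight (side side' : rel nat) P mu nu i j :
  newton_vertex side P mu i -> newton_vertex side' P nu j -> mu = nu.
Proof.
move=> [nzi wi mini] [nzj wj minj].
by have [h1 _] := mini _ nzj; have [h2 _] := minj _ nzi; lia.
Qed.

Lemma newton_vertex_lo P : P != 0 ->
  exists mu, exists i, newton_vertex ltn P mu i.
Proof.
move=> nzP.
have ex_mu: exists mu, [exists i : 'I_(size P), (P`_i != 0) && (weight P`_i i == mu)].
  have lt: ((size P).-1 < size P)%N by rewrite prednK ?lt0n ?size_poly_eq0.
  exists (weight (lead_coef P) (size P).-1); apply/existsP; exists (Ordinal lt).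
  by rewrite /= lead_coef_eq0 nzP eqxx.
case: (ex_minnP ex_mu) => mu /existsP[i0 /andP[nz0 /eqP w0]] min_mu.
have ex_i: exists i, (P`_i != 0) && (weight P`_i i == mu).
  by exists i0; rewrite nz0 w0 eqxx.
case: (ex_minnP ex_i) => i /andP[nzi /eqP wi] min_i.
exists mu, i; split=> // j nzj.
have le_mu: (mu <= weight P`_j j)%N.
  apply: min_mu; have ltj: (j < size P)%N by rewrite ltnNge; apply: contra nzj => /leq_sizeP->.
  by apply/existsP; exists (Ordinal ltj); rewrite nzj eqxx.
split=> // lt_ji; rewrite ltn_neqAle le_mu andbT; apply: contraTneq lt_ji => e.
by rewrite -leqNgt min_i // nzj e eqxx.
Qed.

Lemma newton_vertex_hi P : P != 0 ->
  exists mu, exists i, newton_vertex gtn P mu i.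
Proof.
move=> /newton_vertex_lo[mu [i [nzi wi mini]]].
have ex_i: exists i, (P`_i != 0) && (weight P`_i i == mu).
  by exists i; rewrite nzi wi eqxx.
have bnd j: (P`_j != 0) && (weight P`_j j == mu) -> (j <= size P)%N.
  case/andP=> nzj _; rewrite leqNgt; apply: contra nzj => /ltnW/leq_sizeP->//.
case: (ex_maxnP ex_i bnd) => k /andP[nzk /eqP wk] max_k.
exists mu, k; split=> // j nzj; have [le_mu _] := mini j nzj.
split=> // /= lt_kj; rewrite ltn_neqAle le_mu andbT; apply: contraTneq lt_kj => e.
by rewrite -leqNgt max_k // nzj e eqxx.
Qed.

Hypothesis p_prime : prime p.

Lemma pfactor_dvdz (e : nat) (c : int) :
  c != 0 -> ((p ^ e)%:Z %| c)%Z = (e <= logn p `|c|)%N.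
Proof. by move=> nz_c; rewrite dvdzE /= pfactor_dvdn ?absz_gt0. Qed.

Lemma lognzM (c d : int) :
  c != 0 -> d != 0 -> logn p `|c * d| = (logn p `|c| + logn p `|d|)%N.
Proof. by move=> nz_c nz_d; rewrite abszM lognM ?absz_gt0. Qed.

Lemma weightM (c d : int) i j : c != 0 -> d != 0 ->
  weight (c * d) (i + j) = (weight c i + weight d j)%N.
Proof. by move=> nz_c nz_d; rewrite /weight lognzM //; ring. Qed.

(** Ultrametric inequality: if a sum of valuation [v] had smaller weight, [p^(v + 1)] would divide
    every term, hence the sum. *)
Lemma weight_sum (I : finType) (Q : pred I) (t : I -> int) k (M : nat) :
    (forall i, Q i -> t i != 0 -> (M <= weight (t i) k)%N) ->
  \sum_(i | Q i) t i != 0 -> (M <= weight (\sum_(i | Q i) t i) k)%N.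
Proof.
move=> lb nz_s; rewrite leqNgt; apply/negP=> lt_sM.
have: ((p ^ (logn p `|\sum_(i | Q i) t i|).+1)%:Z %| \sum_(i | Q i) t i)%Z.
  apply: rpred_sum => i Qi.
  have [->|nz_t] := eqVneq (t i) 0; first by rewrite dvdz0.
  rewrite pfactor_dvdz //; have := leq_trans lt_sM (lb i Qi nz_t).
  by rewrite /weight ltn_add2r ltn_mul2l => /andP[].
by rewrite pfactor_dvdz // ltnn.
Qed.

(** The other terms are divisible by a higher power of [p] than [t i0], so they cannot change its
    valuation. *)
Lemma weight_sum_dominant (I : finType) (t : I -> int) k i0 :
    t i0 != 0 ->
    (forall i, i != i0 -> t i != 0 -> (weight (t i0) k < weight (t i) k)%N) ->
  \sum_i t i != 0 /\ weight (\sum_i t i) k = weight (t i0) k.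
Proof.
move=> nz0 lb; rewrite (bigD1 i0) //=; set s := \sum_(i | _) _; set c := t i0.
have dvd_s: ((p ^ (logn p `|c|).+1)%:Z %| s)%Z.
  have [->|nz_s] := eqVneq s 0; first by rewrite dvdz0.
  rewrite pfactor_dvdz //; have := weight_sum lb nz_s.
  by rewrite /weight ltn_add2r ltn_mul2l => /andP[].
have dvd_c: ((p ^ logn p `|c|)%:Z %| c)%Z by rewrite pfactor_dvdz.
have Ndvd_c: ~~ ((p ^ (logn p `|c|).+1)%:Z %| c)%Z by rewrite pfactor_dvdz // ltnn.
have Ndvd: ~~ ((p ^ (logn p `|c|).+1)%:Z %| c + s)%Z.
  by rewrite rpredDr.
have nz: c + s != 0 by apply: contraNneq Ndvd => ->; rewrite dvdz0.
split=> //; congr (a * _ + _)%N; apply/eqP; rewrite eqn_leq.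
rewrite pfactor_dvdz // -ltnNge ltnS in Ndvd; rewrite Ndvd -pfactor_dvdz //.
rewrite rpredD //; apply: dvdz_trans dvd_s; rewrite dvdzE /=.
by rewrite dvdn_exp2l.
Qed.

(** Gauss's lemma for Newton polygons: in the convolution sum at [i + j], the term of index [(i, j)]
    is the only one of minimal weight. Both [ltn] and [gtn] satisfy the conditions on [side]. *)
Lemma newton_vertexM (side : rel nat) P Q mu nu i j :
    (forall i' j', (i' + j' = i + j)%N -> i' != i -> side i' i || side j' j) ->
    (forall i' j', side (i' + j')%N (i + j)%N -> side i' i || side j' j) ->
    newton_vertex side P mu i -> newton_vertex side Q nu j ->
  newton_vertex side (P * Q) (mu + nu) (i + j).
Proof.
move=> side1 side2 [nzP wP minP] [nzQ wQ minQ].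
have lb i' j': P`_i' * Q`_j' != 0 ->
    (mu + nu <= weight (P`_i' * Q`_j') (i' + j'))%N
    /\ (side i' i || side j' j ->
        (mu + nu < weight (P`_i' * Q`_j') (i' + j'))%N).
  rewrite mulf_eq0 negb_or => /andP[nzi nzj]; rewrite weightM //.
  have [h1 h2] := minP _ nzi; have [h3 h4] := minQ _ nzj.
  by split=> [|/orP[/h2|/h4]]; lia.
have lti: (i < (i + j).+1)%N by lia.
have [nz wt]: (P * Q)`_(i + j) != 0 /\ weight (P * Q)`_(i + j) (i + j) = (mu + nu)%N.
  rewrite coefM -wP -wQ -weightM //.
  have := @weight_sum_dominant _ (fun k : 'I_(i + j).+1 => P`_k * Q`_(i + j - k))
    (i + j)%N (Ordinal lti).
  rewrite /= addKn; apply; first by rewrite mulf_neq0.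
  move=> k ne_ki; have Dk: (k + (i + j - k) = i + j)%N by have := ltn_ord k; lia.
  move=> /lb[_]; rewrite Dk [weight (P`_i * _) _]weightM // wP wQ; apply; exact: side1.
split=> // k nzk.
have Dk (l : 'I_k.+1): (l + (k - l) = k)%N by have := ltn_ord l; lia.
rewrite coefM in nzk *; split=> [|sk]; apply: weight_sum nzk => l _ /lb; rewrite Dk.
  by case.
by case=> _; apply; apply: side2; rewrite Dk.
Qed.

Lemma newton_vertex_loM P Q mu nu i j :
    newton_vertex ltn P mu i -> newton_vertex ltn Q nu j ->
  newton_vertex ltn (P * Q) (mu + nu) (i + j).
Proof. by apply: newton_vertexM => i' j' /=; lia. Qed.

Lemma newton_vertex_hiM P Q mu nu i j :
    newton_vertex gtn P mu i -> newton_vertex gtn Q nu j ->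
  newton_vertex gtn (P * Q) (mu + nu) (i + j).
Proof. by apply: newton_vertexM => i' j' /=; lia. Qed.

End NewtonVertices.

(** Convexity: steeper faces lie further left. Cross-multiplying and adding the two minimality
    inequalities gives [(a b' - a' b) (j - i) <= 0]. *)
Lemma newton_vertex_mono p a b a' b' (side side' : rel nat) P mu nu i j :
    (a' * b < a * b')%N ->
    newton_vertex p a b side P mu i -> newton_vertex p a' b' side' P nu j ->
  (j <= i)%N.
Proof.
move=> lt_slope [nzi wi mini] [nzj wj minj].
have [h1 _] := mini _ nzj; have [h2 _] := minj _ nzi.
rewrite leqNgt; apply/negP=> lt_ij; move: h1 h2; rewrite -wi -wj /weight.
set v := logn p _; set w := logn p _ => h1 h2.
have [d dE]: exists d, (j = i + d.+1)%N by exists (j - i.+1)%N; lia.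
subst j; have k1: (a' * (a * v) <= a' * (a * w) + a' * (b * d.+1))%N by nia.
have k2: (a * (a' * w) + a * (b' * d.+1) <= a * (a' * v))%N by nia.
nia.
Qed.

(** * Irreducibility of the truncated exponential *)

Lemma logn_fact_div p i : prime p -> logn p i`! = (i %/ p + logn p (i %/ p)`!)%N.
Proof.
move=> p_pr; have p_gt0 := prime_gt0 p_pr.
elim: i => [|i IHi]; first by rewrite div0n fact0 logn1.
rewrite factS lognM ?fact_gt0 // IHi divnS //.
have [/dvdnP[c Dc]|Ndvd] := boolP (p %| i.+1)%N; last by rewrite lognE p_pr (negPf Ndvd).
have c_gt0: (0 < c)%N by case: (c) Dc.
have Di: (i %/ p = c.-1)%N.
  have := divnS i p_gt0; rewrite Dc dvdn_mull // mulnK //; lia.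
rewrite Di Dc lognM // (pfactorK 1) //=.
by case: c c_gt0 {Dc Di} => // c _; rewrite /= add1n factS lognM ?fact_gt0 //; lia.
Qed.

Lemma leq_logn_fact p i j : (i <= j)%N -> (logn p i`! <= logn p j`!)%N.
Proof.
move=> le_ij; rewrite (fact_split le_ij) dvdn_leq_log ?dvdn_mulr //.
by rewrite -fact_split ?fact_gt0.
Qed.

Lemma ltn_logn_fact p i c :
  prime p -> (i < p * c)%N -> (logn p i`! < logn p (p * c)`!)%N.
Proof.
move=> p_pr lt_i; have p_gt0 := prime_gt0 p_pr; rewrite (logn_fact_div i p_pr) (logn_fact_div (p * c) p_pr).
rewrite mulKn // -addSn leq_add ?leq_logn_fact // ?ltn_divLR //; last 1 first.
  by rewrite -(mulKn c p_gt0) leq_div2r // ltnW.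
by rewrite mulnC.
Qed.

(** Legendre's recursion iterated: [v_p((p^m A)!) = v_p(A!) + A (p^m - 1) / (p - 1)], multiplied by
    [p^m (p - 1)] to match the weights below. *)
Lemma logn_fact_pfactor p m A : prime p ->
  (p ^ m * (p.-1 * logn p (p ^ m * A)`!)
     = p ^ m * (p.-1 * logn p A`!) + (p ^ m).-1 * (p ^ m * A))%N.
Proof.
move=> p_pr; have p_gt0 := prime_gt0 p_pr.
elim: m => [|m IHm]; first by rewrite expn0 !mul1n; lia.
have := logn_fact_div (p ^ m.+1 * A) p_pr; rewrite expnS -mulnA mulKn // => ->.
have: (0 < p ^ m)%N by rewrite expn_gt0 p_gt0.
move: IHm; move: (p ^ m)%N => q IHm q_gt0.
have -> : (p * q).-1 = (q.-1 + q * p.-1)%N.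
  by have := leq_pmulr q p_gt0; rewrite -!subn1 mulnBr muln1; lia.
transitivity (p * (q * (p.-1 * logn p (q * A)`!)) + p * (q * (p.-1 * (q * A))))%N.
  by ring.
by rewrite IHm; ring.
Qed.

(** Here [v_p(i!) - v_p(A!)] is the sum of the floors of [i / p^k] for [1 <= k <= m]. Dropping the
    floors gives the bound; the boolean summand records that it is strict unless [p^m] divides
    [i]. *)
Lemma leq_logn_fact_pfactor p m i (A := (i %/ p ^ m)%N) : prime p ->
  (p ^ m * (p.-1 * logn p i`!) + (p ^ m * A < i)
     <= p ^ m * (p.-1 * logn p A`!) + (p ^ m).-1 * i)%N.
Proof.
move=> p_pr; have p_gt0 := prime_gt0 p_pr; rewrite {}/A.
elim: m => [|m IHm]; first by rewrite expn0 divn1; lia.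
have := logn_fact_div (i %/ p ^ m) p_pr; rewrite -divnMA -expnSr.
have := leq_trunc_div i (p ^ m.+1).
have: (0 < p ^ m)%N by rewrite expn_gt0 p_gt0.
have p'_gt0: (0 < p.-1)%N by have := prime_gt1 p_pr; lia.
move: IHm; rewrite expnS; move: (p ^ m)%N (i %/ _)%N (i %/ _)%N => q B A.
move: (logn p _) (logn p _) (logn p _) => vB vA vi + q_gt0 hB e; rewrite {}e => h.
have k: (p * (q * (p.-1 * vi)) <= p * (q * (p.-1 * (B + vB)) + q.-1 * i))%N.
  rewrite leq_mul2l; apply/orP; right.
  by apply: leq_trans h; rewrite leq_addr.
have k1: ((p * q * B < i) + p.-1 * (p * q * B) <= p.-1 * i)%N.
  have [lt_i|_] := ltnP; last by rewrite add0n leq_mul2l mulnC hB orbT.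
  by apply: (@leq_trans (p.-1 * (p * q * B).+1)); rewrite ?leq_mul2l ?lt_i ?orbT // mulnS; lia.
have -> : (p * q).-1 = (p * q.-1 + p.-1)%N.
  by have := leq_pmulr p q_gt0; rewrite -!subn1 mulnBr muln1; lia.
have e1: (p * (q * (p.-1 * vi)) = p * q * (p.-1 * vi))%N by ring.
have e2: (p * (q * (p.-1 * (B + vB)) + q.-1 * i) =
  p * q * (p.-1 * vB) + p * q.-1 * i + p.-1 * (p * q * B))%N by ring.
rewrite mulnDl; lia.
Qed.

Definition exp_poly (n : nat) : {poly int} := \poly_(i < n.+1) (n`! %/ i`!)%N%:Z.

Lemma dvdn_fact_fact i n : (i <= n)%N -> (i`! %| n`!)%N.
Proof. by move=> le_in; rewrite (fact_split le_in) dvdn_mulr. Qed.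

Lemma exp_poly_coef n i : (i <= n)%N -> (exp_poly n)`_i = (n`! %/ i`!)%N%:Z.
Proof. by move=> le_in; rewrite coef_poly ltnS le_in. Qed.

Lemma exp_poly_coef_neq0 n i : ((exp_poly n)`_i != 0) = (i <= n)%N.
Proof.
rewrite coef_poly ltnS; case: leqP => [le_in|_]; last by rewrite eqxx.
by rewrite -lt0n divn_gt0 ?fact_gt0 // dvdn_leq ?fact_gt0 ?dvdn_fact_fact.
Qed.

Lemma size_exp_poly n : size (exp_poly n) = n.+1.
Proof. by rewrite size_poly_eq // divnn fact_gt0. Qed.

Lemma monic_exp_poly n : exp_poly n \is monic.
Proof. by rewrite monicE lead_coefE size_exp_poly /= exp_poly_coef // divnn fact_gt0. Qed.

(** * Faces of the Newton polygon of [n! f_n] *)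

Section ExpPolyVertices.

Variables (n p m : nat).
Hypothesis p_prime : prime p.

(** With [b] below, [b / a = 1/p + ... + 1/p^m], which increases with [m]. *)
Let a := (p ^ m * p.-1)%N.
Let b := (p ^ m).-1.
Let N := (n %/ p ^ m)%N.

Let weight_exp_poly i : (i <= n)%N ->
  (weight p a b (exp_poly n)`_i i + p ^ m * (p.-1 * logn p i`!) =
     p ^ m * (p.-1 * logn p n`!) + (p ^ m).-1 * i)%N.
Proof.
move=> le_in; rewrite exp_poly_coef // /weight absz_nat logn_div ?dvdn_fact_fact //.
rewrite /a /b; have := leq_logn_fact p le_in; nia.
Qed.

(** The minimal weight, attained exactly at the [i = p^m A <= n] with [v_p(A!) = v_p(N!)]. *)
Let mu := (p ^ m * (p.-1 * (logn p n`! - logn p N`!)))%N.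

Let pm_gt0 : (0 < p ^ m)%N. Proof. by rewrite expn_gt0 prime_gt0. Qed.

Let leN : (N <= n)%N. Proof. exact: leq_div. Qed.

Let weight_multiple A : (p ^ m * A <= n)%N -> logn p A`! = logn p N`! ->
  weight p a b (exp_poly n)`_(p ^ m * A) (p ^ m * A) = mu.
Proof.
move=> le_A eA; have := weight_exp_poly le_A; rewrite logn_fact_pfactor // eA.
rewrite /mu; have := leq_logn_fact p leN; nia.
Qed.

Let weight_lb i : (i <= n)%N ->
  [/\ (mu <= weight p a b (exp_poly n)`_i i)%N,
      (p ^ m * (i %/ p ^ m) < i)%N -> (mu < weight p a b (exp_poly n)`_i i)%N
    & (logn p (i %/ p ^ m)`! < logn p N`!)%N -> (mu < weight p a b (exp_poly n)`_i i)%N].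
Proof.
move=> le_in; have := weight_exp_poly le_in; have := leq_logn_fact_pfactor m i p_prime.
have := leq_logn_fact p leN.
have: (logn p (i %/ p ^ m)`! <= logn p N`!)%N by rewrite leq_logn_fact ?leq_div2r.
have p1_gt0: (0 < p.-1)%N by have := prime_gt1 p_prime; lia.
rewrite /mu; set vA := logn p (i %/ p ^ m)`!; set vN := logn p N`!.
set vn := logn p n`!; set vi := logn p i`! => h1 h2 h3 h4.
have k1: (p ^ m * (p.-1 * vA) <= p ^ m * (p.-1 * vN))%N by rewrite !leq_mul2l h1 !orbT.
have k2: (vA < vN)%N -> (p ^ m * (p.-1 * vA) < p ^ m * (p.-1 * vN))%N.
  by move=> h; rewrite !ltn_mul2l h p1_gt0 pm_gt0.
have k0: (p ^ m * (p.-1 * vN) <= p ^ m * (p.-1 * vn))%N by rewrite !leq_mul2l h2 !orbT.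
rewrite mulnBr mulnBr; move: h3 h4 k0 k1 k2.
set wA := (p ^ m * (p.-1 * vA))%N; set wN := (p ^ m * (p.-1 * vN))%N.
set wn := (p ^ m * (p.-1 * vn))%N; set wi := (p ^ m * (p.-1 * vi))%N.
set s := ((p ^ m).-1 * i)%N; set t := (p ^ m * _)%N => h3 h4 k0 k1 k2.
by split=> [|h|/k2 h]; lia.
Qed.

Lemma exp_poly_hi : newton_vertex p a b gtn (exp_poly n) mu (p ^ m * N).
Proof.
have le_N: (p ^ m * N <= n)%N by rewrite mulnC leq_trunc_div.
split; last 1 first; first 2 last.
- by rewrite weight_multiple.
- move=> j; rewrite exp_poly_coef_neq0 => le_jn.
  have [h1 h2 _] := weight_lb le_jn; split=> //= lt; apply: h2.
  by rewrite (leq_ltn_trans _ lt) // leq_mul2l leq_div2r ?orbT.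
- by rewrite exp_poly_coef_neq0.
Qed.

(** For [A <= N], [v_p(A!) = v_p(N!)] means [A >= p (N %/ p)]; so this face starts where the face of
    index [m + 1] ends. *)
Lemma exp_poly_lo :
  newton_vertex p a b ltn (exp_poly n) mu (p ^ m.+1 * (n %/ p ^ m.+1)).
Proof.
have le_N: (p ^ m.+1 * (n %/ p ^ m.+1) <= n)%N by rewrite mulnC leq_trunc_div.
have DN: (n %/ p ^ m.+1 = N %/ p)%N by rewrite expnSr divnMA.
have eN: logn p (p * (N %/ p))`! = logn p N`!.
  by rewrite (logn_fact_div (p * _) p_prime) (logn_fact_div N p_prime) mulKn ?prime_gt0.
split; last 1 first; first 2 last.
- move: le_N; rewrite DN expnSr -mulnA => le_N; exact: weight_multiple.
- move=> j; rewrite exp_poly_coef_neq0 => le_jn.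
  have [h1 _ h3] := weight_lb le_jn; split=> //= lt; apply: h3; rewrite -eN.
  by rewrite ltn_logn_fact // ltn_divLR // -DN mulnC mulnA -expnSr.
- by rewrite exp_poly_coef_neq0.
Qed.

End ExpPolyVertices.

Lemma exp_poly_neq0 n : exp_poly n != 0.
Proof. exact/monic_neq0/monic_exp_poly. Qed.

(* Coleman's argument: all faces of the Newton polygon of [exp_poly n] at [p]
   whose slope has denominator [p ^ m] have length divisible by [p ^ m], and
   this is inherited by every factor. *)
Lemma pfactor_dvd_exp_poly_factor n p k (G H : {poly int}) :
    prime p -> (0 < n)%N -> (p ^ k %| n)%N -> exp_poly n = G * H ->
  (p ^ k %| (size G).-1)%N.
Proof.
move=> p_pr n_gt0 dvd_pk DF.
have nzG: G != 0 by apply: contraNneq (exp_poly_neq0 n) => G0; rewrite DF G0 mul0r.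
have nzH: H != 0 by apply: contraNneq (exp_poly_neq0 n) => H0; rewrite DF H0 mulr0.
have p_gt0 := prime_gt0 p_pr.
pose a m := (p ^ m * p.-1)%N; pose b m := (p ^ m).-1.
have hiE m i j mu nu : newton_vertex p (a m) (b m) gtn G mu i ->
    newton_vertex p (a m) (b m) gtn H nu j -> (i + j = p ^ m * (n %/ p ^ m))%N.
  move=> vG vH; have := newton_vertex_hiM p_pr vG vH; rewrite -DF => vF.
  by apply: newton_vertex_inj vF (exp_poly_hi n m p_pr) => i' j' /=; lia.
have loE m i j mu nu : newton_vertex p (a m) (b m) ltn G mu i ->
    newton_vertex p (a m) (b m) ltn H nu j -> (i + j = p ^ m.+1 * (n %/ p ^ m.+1))%N.
  move=> vG vH; have := newton_vertex_loM p_pr vG vH; rewrite -DF => vF.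
  by apply: newton_vertex_inj vF (exp_poly_lo n m p_pr) => i' j' /=; lia.
have slope m : (a m.+1 * b m < a m * b m.+1)%N.
  have q_gt0: (0 < p ^ m)%N by rewrite expn_gt0 p_gt0.
  have p'_gt0: (0 < p.-1)%N by have := prime_gt1 p_pr; lia.
  rewrite /a /b expnS; set q := (p ^ m)%N in q_gt0 *.
  have -> : (p * q * p.-1 * q.-1 = q * p.-1 * (p * q.-1))%N by ring.
  rewrite ltn_mul2l muln_gt0 q_gt0 p'_gt0 /= -!subn1 mulnBr muln1.
  have := leq_pmulr p q_gt0; have := prime_gt1 p_pr; lia.
(* Downward induction on [m], starting where [n < p^m] and the right end is 0. *)
have hi_dvd d m : (n < p ^ (m + d))%N ->
    forall mu i, newton_vertex p (a m) (b m) gtn G mu i -> (p ^ m %| i)%N.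
  elim: d m => [|d IHd] m lt_n mu i vG.
    have [nu [j vH]] := newton_vertex_hi p (a m) (b m) nzH.
    have := hiE _ _ _ _ _ vG vH; rewrite addn0 in lt_n; rewrite divn_small // muln0.
    by case: i {vG}.
  have [mu' [i' vG']] := newton_vertex_hi p (a m.+1) (b m.+1) nzG.
  have [nu' [j' vH']] := newton_vertex_hi p (a m.+1) (b m.+1) nzH.
  have [mu0 [i0 vG0]] := newton_vertex_lo p (a m) (b m) nzG.
  have [nu0 [j0 vH0]] := newton_vertex_lo p (a m) (b m) nzH.
  (* In the product, the face of index [m + 1] ends where that of index [m] starts; by convexity the
     same holds in each factor. *)
  have Di0 : i0 = i'.
    have := newton_vertex_mono (slope m) vG0 vG'.
    have := newton_vertex_mono (slope m) vH0 vH'.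
    by have := hiE _ _ _ _ _ vG' vH'; have := loE _ _ _ _ _ vG0 vH0; lia.
  have dvd_i': (p ^ m.+1 %| i')%N by apply: IHd vG'; rewrite addSnnS.
  have dvd_i0: (p ^ m %| i0)%N.
    by rewrite Di0 (dvdn_trans _ dvd_i') // dvdn_exp2l.
  have := newton_vertex_weight vG0 vG.
  have le_i0: (i0 <= i)%N.
    case: vG0 vG => nz0 w0 min0 [nz w min].
    have [h1 h2] := min0 _ nz; have [h3 h4] := min _ nz0.
    by rewrite leqNgt; apply/negP=> lt_i; have := h4 lt_i; lia.
  have [_ w0 _] := vG0; have [_ w _] := vG; move=> e; move: w0 w; rewrite e /weight.
  move=> <- /esym e1.
  (* The two ends of the face have equal weight, and [b m = p^m - 1] is prime to [p^m]. *)
  have: (p ^ m %| b m * (i - i0))%N.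
    have -> : (b m * (i - i0) = a m * (logn p `|(G`_i0)%R| - logn p `|(G`_i)%R|))%N.
      rewrite !mulnBr; lia.
    by rewrite /a -mulnA dvdn_mulr.
  rewrite Gauss_dvdr; last first.
    by rewrite coprimenP // expn_gt0 p_gt0.
  by move=> dvd_d; rewrite -(subnK le_i0) dvdn_add.
have [mu [i vG]] := newton_vertex_hi p (a k) (b k) nzG.
have [nu [j vH]] := newton_vertex_hi p (a k) (b k) nzH.
have: (p ^ k %| i)%N.
  apply: (hi_dvd n _ _ _ _ vG); apply: leq_trans (ltn_expl n (prime_gt1 p_pr)) _.
  by rewrite leq_exp2l ?prime_gt1 // leq_addl.
(* As [p^k] divides [n], the right end for the product is its degree [n], so those of the factors
   are their degrees. *)
have := hiE _ _ _ _ _ vG vH; rewrite mulnC divnK // => Dn.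
suff -> : i = (size G).-1 by [].
have ltsz (P : {poly int}) l : P`_l != 0 -> (l < size P)%N.
  by rewrite ltnNge; apply: contra => /leq_sizeP->.
have [/ltsz ltG _ _] := vG; have [/ltsz ltH _ _] := vH.
have := size_exp_poly n; rewrite DF size_mul //.
by move: (size G) (size H) ltG ltH; lia.
Qed.

Lemma exp_poly_factor n (G H : {poly int}) :
  (0 < n)%N -> exp_poly n = G * H -> (n %| (size G).-1)%N.
Proof.
move=> n_gt0 DF; have [->|nz_d] := posnP (size G).-1; first exact: dvdn0.
apply/dvdn_partP=> // p; rewrite mem_primes => /and3P[p_pr _ _].
by rewrite p_part; apply: pfactor_dvd_exp_poly_factor DF; rewrite // -p_part dvdn_part.
Qed.

Lemma irreducible_exp_poly n :
  (0 < n)%N -> irreducible_poly (map_poly (intr : int -> rat) (exp_poly n)).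
Proof.
move=> n_gt0; split; first by rewrite size_rat_int_poly size_exp_poly.
(* By Gauss's lemma a rational divisor is a scalar multiple of an integral factor. *)
move=> q sz_q dvd_q; have /dvdpP_rat_int[G [c nz_c Dq] [H DF]] := dvd_q.
rewrite -(dvdp_size_eqp dvd_q) Dq size_scale // !size_rat_int_poly size_exp_poly.
have nzG: G != 0 by apply: contraNneq (exp_poly_neq0 n) => G0; rewrite DF G0 mul0r.
have nzH: H != 0 by apply: contraNneq (exp_poly_neq0 n) => H0; rewrite DF H0 mulr0.
have := exp_poly_factor n_gt0 DF; have := size_exp_poly n; rewrite DF size_mul //.
move: sz_q; rewrite Dq size_scale // size_rat_int_poly.
have := size_poly_eq0 G; have := size_poly_eq0 H; rewrite (negPf nzG) (negPf nzH).
by move: (size G) (size H) => sG sH szH szG sz1 szGH /dvdn_leq; lia.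
Qed.

(** * Index and torsion of a finite quotient *)

(** [A / B] is isomorphic to a subgroup of the finite group [W], since [psi] covers [A] and [pi]
    detects [B]. Cauchy's theorem then relates divisors of its order to [p]-torsion. *)
Lemma has_index_finite_quotient (V U : zmodType) (W : finZmodType)
    (A B : V -> Prop) (psi : U -> V) (pi : U -> W) (s : W -> U) :
    {morph psi : u v / u - v} -> {morph pi : u v / u - v} -> cancel s pi ->
    A 0 -> (forall x y, A x -> A y -> A (x - y)) ->
    (forall x, B x -> A x) -> (forall u, B (psi u) <-> pi u = 0) ->
    (forall x, A x -> exists u, x = psi u) ->
  exists2 N, has_index A B N
    & forall p, prime p ->
        ((p %| N)%N <-> exists x, [/\ A x, ~ B x & B (x *+ p)]).
Proof.
move=> psiB piB sK A0 AB BA Bpsi psi_onto.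
have psi0: psi 0 = 0 by rewrite -(subrr 0) psiB subrr.
have pi0: pi 0 = 0 by rewrite -(subrr 0) piB subrr.
have AN x : A x -> A (- x) by move=> Ax; rewrite -sub0r; apply: AB.
have AD x y : A x -> A y -> A (x + y) by move=> Ax Ay; rewrite -[y]opprK; apply/AB/AN.
have piN u : pi (- u) = - pi u by rewrite -sub0r piB pi0 sub0r.
have piD u v : pi (u + v) = pi u + pi v by rewrite -{1}[v]opprK piB piN opprK.
have psiN u : psi (- u) = - psi u by rewrite -sub0r psiB psi0 sub0r.
have psiD u v : psi (u + v) = psi u + psi v by rewrite -{1}[v]opprK psiB psiN opprK.
have piMn u k : pi (u *+ k) = pi u *+ k.
  by elim: k => [|k IHk]; rewrite ?mulr0n // !mulrS piD IHk.
have psiMn u k : psi (u *+ k) = psi u *+ k.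
  by elim: k => [|k IHk]; rewrite ?mulr0n // !mulrS psiD IHk.
(* The image under [pi] of the preimage of [A]. The section [s] need not be additive: [piG] shows
   that the choice of lift is immaterial. *)
pose G := [set w | if excluded_middle_informative (A (psi (s w))) then true else false].
have inG w : w \in G <-> A (psi (s w)).
  by rewrite inE; case: excluded_middle_informative.
have piG u : A (psi u) <-> pi u \in G.
  have Bd: A (psi (s (pi u) - u)) by apply/BA/Bpsi; rewrite piB sK subrr.
  rewrite inG; split=> Au; first by rewrite -(subrK (psi u) (psi _)) -psiB; apply: AD.
  by rewrite -(subKr (psi (s (pi u))) (psi u)) -psiB; apply: AB.
have gG: group_set G.
  apply/group_setP; split=> [|v w /inG Av /inG Aw].
    by rewrite -[1%g]/(0 : W) -pi0; apply/piG; rewrite psi0.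
  rewrite -[v]sK -[w]sK -[(_ * _)%g]/(_ + _) -piD; apply/piG.
  by rewrite psiD; apply: AD.
exists #|G|.
  split=> //; exists (fun i : 'I_#|G| => psi (s (enum_val i))); split=> [i|x Ax].
    exact/inG/enum_valP.
  have [u Dx] := psi_onto x Ax; rewrite {x}Dx in Ax *.
  have Gu: pi u \in G by apply/piG.
  exists (enum_rank_in Gu (pi u)); split=> [|i].
    by rewrite enum_rankK_in // -psiB; apply/Bpsi; rewrite piB sK subrr.
  rewrite -psiB => /Bpsi; rewrite piB sK => /subr0_eq Du.
  by apply: enum_val_inj; rewrite enum_rankK_in.
move=> p p_pr; split=> [/(Cauchy (G := Group gG) p_pr)[w Gw ow]|[x [Ax nBx Bxp]]].
  exists (psi (s w)); split; first exact/inG.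
    move=> /Bpsi; rewrite sK => w0; have := prime_gt1 p_pr.
    by rewrite -ow w0 -[0]/(1%g) order1.
  by rewrite -psiMn; apply/Bpsi; rewrite piMn sK -ow; apply: expg_order.
have [u Dx] := psi_onto x Ax; rewrite {x}Dx in Ax nBx Bxp.
have Gu: pi u \in Group gG by apply/piG.
have := order_dvdG Gu; suff -> : #[pi u]%g = p by [].
have: (#[pi u]%g %| p)%N.
  by rewrite order_dvdn; apply/eqP; move: Bxp; rewrite -psiMn => /Bpsi; rewrite piMn.
have [_ p_div] := primeP p_pr; case/p_div/orP=> [|/eqP//].
by rewrite order_eq1 => /eqP u1; case: nBx; apply/Bpsi.
Qed.

(** * The order generated by a root of a monic irreducible polynomial *)

Section MonicRoot.

Variables (L : fieldExtType rat) (theta : L) (F : {poly int}).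
Hypothesis monF : F \is monic.
Hypothesis irrF : irreducible_poly (map_poly (intr : int -> rat) F).
Hypothesis rootF : root (map_poly intr F) theta.

Local Notation pZtoQ := (map_poly (intr : int -> rat)).
Local Notation evQ q := (map_poly (in_alg L) q).[theta].
Local Notation evZ q := (map_poly (intr : int -> L) q).[theta].
Local Notation ZK := (ring_of_integers <<1; theta>>%AS).

Lemma horner_pZtoQ q : evQ (pZtoQ q) = evZ q.
Proof.
rewrite -map_poly_comp; congr _.[_]; apply: eq_map_poly => c.
exact: (rmorph_int (in_alg L)).
Qed.

Lemma evQ_root : evQ (pZtoQ F) = 0.
Proof. by rewrite horner_pZtoQ; apply/eqP. Qed.

(** Otherwise the two polynomials would be coprime, and could not share the root [theta]. *)
Lemma irreducible_root_dvdp (q : {poly rat}) : evQ q = 0 -> pZtoQ F %| q.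
Proof.
move=> q0; apply: contraT; rewrite -irreducible_poly_coprime // -(coprimep_map (in_alg L)).
by move=> /coprimep_root/(_ (introT eqP evQ_root)); rewrite q0 eqxx.
Qed.

Lemma root_dvdp_int (q : {poly int}) : evZ q = 0 -> exists r, q = r * F.
Proof.
rewrite -horner_pZtoQ => /irreducible_root_dvdp; rewrite dvdp_rat_int.
by move/(Pdiv.IdomainMonic.dvdpP monF).
Qed.

Lemma evQ_inj (q r : {poly rat}) :
  (size q < size F)%N -> (size r < size F)%N -> evQ q = evQ r -> q = r.
Proof.
move=> szq szr eq_qr; apply/subr0_eq/eqP/negPn/negP => nz.
have /irreducible_root_dvdp/(dvdp_leq nz): evQ (q - r) = 0.
  by rewrite rmorphB hornerD hornerN eq_qr subrr.
rewrite size_rat_int_poly leqNgt => /negP[]; apply: leq_ltn_trans (size_polyD _ _) _.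
by rewrite size_polyN gtn_max szq.
Qed.

Lemma evZ_inj (q r : {poly int}) :
  (size q < size F)%N -> (size r < size F)%N -> evZ q = evZ r -> q = r.
Proof.
move=> szq szr; rewrite -!horner_pZtoQ => /evQ_inj; rewrite !size_rat_int_poly.
by move=> /(_ szq szr)/map_inj_poly; apply=> //; apply: intr_inj.
Qed.

Lemma adjoin_evQ x : x \in <<1; theta>>%VS -> exists q, x = evQ q.
Proof. by case/Fadjoin_polyP=> q /polyOver1P[r ->] ->; exists r. Qed.

Lemma evQ_adjoin q : evQ q \in <<1; theta>>%VS.
Proof. by apply/Fadjoin_polyP; exists (map_poly (in_alg L) q) => //; apply/polyOver1P; exists q. Qed.

Lemma Zadjoin_small x :
  Zadjoin theta x -> exists2 q : {poly int}, (size q < size F)%N & x = evZ q.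
Proof.
case=> q ->; exists (Pdiv.CommonRing.rmodp q F).
  by rewrite Pdiv.CommonRing.ltn_rmodpN0 // monic_neq0.
rewrite {1}(Pdiv.RingMonic.rdivp_eq monF q) rmorphD rmorphM hornerD hornerM /=.
by rewrite (eqP rootF) mulr0 add0r.
Qed.

Lemma ZadjoinB x y : Zadjoin theta x -> Zadjoin theta y -> Zadjoin theta (x - y).
Proof. by move=> [q ->] [r ->]; exists (q - r); rewrite rmorphB hornerD hornerN. Qed.

Lemma ZadjoinM x y : Zadjoin theta x -> Zadjoin theta y -> Zadjoin theta (x * y).
Proof. by move=> [q ->] [r ->]; exists (q * r); rewrite rmorphM hornerM. Qed.

Lemma Zadjoin_int (m : int) : Zadjoin theta m%:~R.
Proof. by exists m%:P; rewrite map_polyC hornerC. Qed.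

Lemma Zadjoin_root : Zadjoin theta theta.
Proof. by exists 'X; rewrite map_polyX hornerX. Qed.

Lemma integral_theta : integralOver (intr : int -> L) theta.
Proof. by exists F. Qed.

Lemma Zadjoin_integral x : Zadjoin theta x -> ZK x.
Proof.
case=> q ->; split; first by rewrite -horner_pZtoQ evQ_adjoin.
apply: integral_horner integral_theta; apply/integral_poly=> i.
by rewrite coef_map; apply: integral_id.
Qed.

Lemma ZKB x y : ZK x -> ZK y -> ZK (x - y).
Proof. by move=> [Kx Ix] [Ky Iy]; split; [apply: rpredB | apply: integral_sub]. Qed.

Lemma ZKM x y : ZK x -> ZK y -> ZK (x * y).
Proof. by move=> [Kx Ix] [Ky Iy]; split; [apply: rpredM | apply: integral_mul]. Qed.

(* If [x = q(theta)], then [F' q mod F] is the Lagrange interpolation polynomial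
   [\sum_z q(z) F / (X - z)] over the complex roots [z] of [F]; its
   coefficients are both rational and integral over [Z]. *)
Lemma different_conductor x : ZK x -> Zadjoin theta (evZ F^`() * x).
Proof.
case=> /adjoin_evQ[q ->] [P monP rootP].
pose FQ := pZtoQ F; pose toC := map_poly (ratr : rat -> algC).
have ZQC (g : {poly int}): toC (pZtoQ g) = map_poly intr g.
  by rewrite /toC -map_poly_comp; apply: eq_map_poly => c /=; rewrite ratr_int.
have int_polyOver (g : {poly int}): map_poly (intr : int -> algC) g \is a polyOver Num.int.
  by apply/polyOverP=> i; rewrite coef_map /= intr_int.
have rootA z : root (toC FQ) z -> z \in Aint.
  by rewrite ZQC => Fz; apply: root_monic_Aint Fz _ (int_polyOver F); rewrite (monic_map _ monF).
(* [F] divides [P \Po q], so [q(z)] is a root of the monic [P], like its conjugate [x]. *)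
have rootqA z : root (toC FQ) z -> (toC q).[z] \in Aint.
  move=> Fz; have: FQ %| pZtoQ P \Po q.
    apply: irreducible_root_dvdp; rewrite map_comp_poly horner_comp.
    rewrite -map_poly_comp; apply/eqP; move: rootP; rewrite /root.
    congr (_.[_] == 0); apply: eq_map_poly => c; exact/esym/(rmorph_int (in_alg L)).
  rewrite -(dvdp_map (ratr : {rmorphism rat -> algC})) => /root_dvdp/(_ Fz).
  rewrite map_comp_poly /root horner_comp -/toC ZQC => Pz.
  by apply: root_monic_Aint Pz _ (int_polyOver P); rewrite (monic_map _ monP).
pose R := (FQ^`() * q) %% FQ; have nzFQ := irredp_neq0 irrF.
have [rs Drs] := closed_field_poly_normal (toC FQ).
have monFC: toC FQ \is monic by rewrite ZQC monic_map.
rewrite (monicP monFC) scale1r in Drs.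
have rsP z : (z \in rs) = root (toC FQ) z by rewrite Drs root_prod_XsubC.
have uniq_rs: uniq rs.
  rewrite -separable_prod_XsubC -Drs separable_map unlock irreducible_poly_coprime //.
  have nzF': FQ^`() != 0.
    have [+ _] := irrF; rewrite -/FQ; case Dsz: (size FQ) => [|[|k]] // _.
    apply/eqP=> /polyP/(_ k)/eqP; rewrite coef_deriv coef0 mulrn_eq0 /=.
    have: lead_coef FQ != 0 by rewrite lead_coef_eq0.
    by rewrite lead_coefE Dsz => /negPf->.
  by apply/negP=> /(dvdp_leq nzF'); rewrite leqNgt lt_size_deriv.
(* Both sides have degree less than that of [F] and agree at its distinct roots:
   [R(z) = F'(z) q(z)], and [F'(z)] is the product of [z - y] over the other roots [y]. *)
have DR: toC R = \sum_(z <- rs) (toC q).[z] *: \prod_(y <- rem z rs) ('X - y%:P).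
  apply/subr0_eq/(roots_geq_poly_eq0 _ uniq_rs).
    apply/allP=> z rs_z; rewrite /root hornerD hornerN horner_sum (bigD1_seq z) //=.
    rewrite [X in _ - (_ + X)]big1_seq => [|y /andP[ne_yz rs_y]]; last first.
      apply/eqP; rewrite hornerZ mulf_eq0 -/(root _ z) root_prod_XsubC.
      by rewrite mem_rem_uniq // !inE [z == y]eq_sym ne_yz rs_z orbT.
    have Fz0: (toC FQ).[z] = 0 by apply/eqP; rewrite -/(root _ z) -rsP.
    have: (toC (FQ^`() * q)).[z] = (toC R).[z].
      rewrite (divp_eq (FQ^`() * q) FQ) /toC rmorphD rmorphM hornerD hornerM /=.
      by rewrite Fz0 mulr0 add0r.
    rewrite addr0 => <-; rewrite /toC rmorphM hornerM hornerZ /= -deriv_map -/toC.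
    rewrite Drs (big_rem z) //= derivM hornerD !hornerM hornerXsubC subrr mul0r addr0.
    by rewrite derivXsubC hornerC mul1r mulrC subrr.
  have szrs: size rs = (size FQ).-1.
    by rewrite -(size_map_poly (ratr : {rmorphism rat -> algC})) -/toC Drs size_prod_XsubC.
  have sz_gt0: (0 < size FQ)%N by rewrite lt0n size_poly_eq0.
  rewrite szrs (leq_trans (size_polyD _ _)) // size_polyN geq_max; apply/andP; split.
    by rewrite size_map_poly -ltnS prednK // ltn_modpN0.
  apply: (leq_trans (size_sum _ _ _)); apply/bigmax_leqP_seq => z rs_z _.
  by rewrite (leq_trans (size_scale_leq _ _)) // size_prod_XsubC size_rem // -szrs; case: (rs) rs_z.
have RA: toC R \is a polyOver Aint.
  rewrite DR big_seq; apply: rpred_sum => z rs_z; apply: polyOverZ.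
    by apply: rootqA; rewrite -rsP.
  rewrite big_seq; apply: rpred_prod => y /mem_rem rs_y.
  by rewrite polyOverXsubC; apply: rootA; rewrite -rsP.
have RZ: R \is a polyOver Num.int.
  apply/polyOverP=> i; rewrite -Cint_rat; have /polyOverP/(_ i) := RA.
  by rewrite coef_map => /Cint_rat_Aint; apply; apply: Crat_rat.
have [r Dr] := floorpP RZ; exists r; rewrite -(horner_pZtoQ r) -Dr.
have -> : evZ F^`() = evQ FQ^`() by rewrite -horner_pZtoQ deriv_map.
rewrite -hornerM -rmorphM (divp_eq (FQ^`() * q) FQ) rmorphD rmorphM hornerD hornerM /=.
by rewrite evQ_root mulr0 add0r.
Qed.

(** In the power basis [Z[theta]] is [Z^n] and [ZK] lies in [(1/D) Z^n], so the quotient embeds in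
    [(Z/D)^n]. The bound [1 < D] makes ['Z_D] the integers modulo [D]. *)
Lemma has_index_Zadjoin (D : nat) : (1 < D)%N ->
    (forall x, ZK x -> Zadjoin theta (D%:R * x)) ->
  exists2 N, has_index ZK (Zadjoin theta) N
    & forall p, prime p ->
        ((p %| N)%N <-> exists x, [/\ ZK x, ~ Zadjoin theta x & Zadjoin theta (x *+ p)]).
Proof.
move=> D_gt1 denom; have szF: (0 < size F)%N by rewrite lt0n size_poly_eq0 monic_neq0.
set n := (size F).-1.
have nzD: D%:R != 0 :> L.
  by rewrite -(rmorph_nat (in_alg L)) fmorph_eq0 pnatr_eq0 -lt0n ltnW.
have szr (u : 'rV[int]_n): (size (rVpoly u) < size F)%N by rewrite -(prednK szF) ltnS size_poly.
have Zp_intr0 (m : int): (m%:~R == 0 :> 'Z_D) = (D %| m)%Z.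
  have natr0 k : (k%:R == 0 :> 'Z_D) = (D %| k)%N.
    by rewrite -val_eqE /= val_Zp_nat.
  rewrite dvdzE; case: m => k; first exact: natr0.
  by rewrite NegzE rmorphN oppr_eq0 abszN; apply: natr0.
pose psi (u : 'rV[int]_n) := evZ (rVpoly u) / D%:R.
apply: (@has_index_finite_quotient _ _ 'rV['Z_D]_n _ _ psi (map_mx intr)
  (map_mx (fun z : 'Z_D => (z : nat)%:Z))).
- by move=> u v; rewrite /psi linearB rmorphB hornerD hornerN mulrBl.
- by move=> u v; rewrite map_mxB.
- by move=> w; apply/rowP=> i; rewrite !mxE -pmulrn natr_Zp.
- by apply: Zadjoin_integral; exists 0; rewrite rmorph0 horner0.
- exact: ZKB.
- exact: Zadjoin_integral.
- move=> u; split=> [/Zadjoin_small[q szq Dq]|u0].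
    have Du: rVpoly u = q *+ D.
      apply: evZ_inj => //.
        by rewrite -scaler_nat (leq_ltn_trans (size_scale_leq _ _)).
      by rewrite rmorphMn hornerMn -Dq -mulr_natr divfK.
    apply/rowP=> i; rewrite !mxE -coef_rVpoly_ord Du coefMn; apply/eqP.
    by rewrite Zp_intr0 -mulr_natr natz dvdz_mull.
  have [v ->]: exists v, u = v *+ D.
    exists (map_mx (fun m : int => (m %/ D)%Z) u); apply/rowP=> i.
    rewrite mulmxnE mxE -mulr_natr natz divzK //; have /rowP/(_ i)/eqP := u0.
    by rewrite !mxE Zp_intr0.
  by exists (rVpoly v); rewrite /psi raddfMn rmorphMn hornerMn -mulr_natr mulfK.
- move=> x /denom/Zadjoin_small[q szq Dq]; exists (poly_rV q).
  rewrite /psi poly_rV_K; last by rewrite -ltnS prednK.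
  by rewrite -Dq [RHS]mulrC mulKf.
Qed.

Lemma Zadjoin_coprime (a b : int) x : coprimez a b ->
  Zadjoin theta (a%:~R * x) -> Zadjoin theta (b%:~R * x) -> Zadjoin theta x.
Proof.
move=> /eqP co_ab Aa Ab; have [u [v Duv]] := Bezoutz a b.
have -> : x = u%:~R * (a%:~R * x) - (- v)%:~R * (b%:~R * x).
  by rewrite !mulrA -!intrM -mulrBl -intrB mulNr opprK Duv co_ab mul1r.
by apply: ZadjoinB; apply: ZadjoinM => //; apply: Zadjoin_int.
Qed.

Lemma poly_split0 (q : {poly int}) : exists q1, q = q1 * 'X + (q`_0)%:P.
Proof.
exists (drop_poly 1 q); rewrite -{1}(poly_take_drop 1 q) addrC; congr (_ + _).
by apply/polyP=> -[|i]; rewrite coef_take_poly coefC.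
Qed.

Lemma evZ_split0 (q q1 : {poly int}) (c : int) :
  q = q1 * 'X + c%:P -> evZ q = evZ q1 * theta + c%:~R.
Proof.
by move->; rewrite rmorphD rmorphM /= map_polyX map_polyC hornerD hornerM hornerX hornerC.
Qed.

(* If [theta * z] is an integer [a], then [F] divides the polynomial
   [X ^ d * P (a / X)], where [P] is a monic integer polynomial of degree [d]
   killing [z]. *)
Lemma integral_quotient_root (a : int) z :
  integralOver (intr : int -> L) z -> theta * z = a%:~R -> exists d, (F`_0 %| a ^+ d)%Z.
Proof.
move=> [P monP rootP] Dtz; pose d := (size P).-1; exists d.
have szP: size P = d.+1 by rewrite prednK // lt0n size_poly_eq0 monic_neq0.
pose Q : {poly int} := \sum_(i < d.+1) (P`_i * a ^+ i) *: 'X^(d - i).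
have /root_dvdp_int[r Dr]: evZ Q = 0.
  rewrite rmorph_sum horner_sum; transitivity (theta ^+ d * (map_poly intr P).[z]); last first.
    by rewrite (eqP rootP) mulr0.
  rewrite horner_coef size_map_poly_id0 ?(monicP monP) ?oner_eq0 // szP mulr_sumr.
  apply: eq_bigr => i _; rewrite /= map_polyZ /= map_polyXn hornerZ hornerXn coef_map /=.
  have -> : theta ^+ d = theta ^+ (d - i) * theta ^+ i.
    by rewrite -exprD subnK // -ltnS.
  rewrite rmorphM rmorphXn /= -Dtz exprMn; ring.
have: Q`_0 = a ^+ d.
  rewrite coef_sum (bigD1 ord_max) //= big1 ?addr0 => [|i ne_i].
    by rewrite coefZ subnn expr0 coef1 mulr1 -[d]/(d.+1.-1) -szP -lead_coefE (monicP monP) mul1r.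
  rewrite coefZ coefXn eq_sym subn_eq0 leqNgt.
  have -> : (i < d)%N by have := ltn_ord i; rewrite ltnS leq_eqVlt -val_eqE /= in ne_i *; rewrite (negPf ne_i).
  by rewrite mulr0.
by move=> <-; rewrite Dr coef0M dvdz_mull.
Qed.

(** * Maximality of [Z[theta]] at the ideal [(p, theta)] *)

Section PrimeAtRootZero.

Variable p : nat.
Hypothesis p_prime : prime p.

Section OneStep.

Variable u : int.
Hypothesis F0E : F`_0 = p%:Z * u.
Hypothesis p'u : ~~ (p %| u)%Z.

Lemma maximal_at_theta_step y :
    ZK y -> Zadjoin theta (p%:R * y) -> Zadjoin theta (theta * y) ->
  Zadjoin theta y.
Proof.
move=> ZKy Apy [a Da]; have [a1 Da1] := poly_split0 a; have [c Dc] := poly_split0 F.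
have Aa1: Zadjoin theta (evZ a1) by exists a1.
pose z := y - evZ a1; have ZKz: ZK z by apply: ZKB => //; apply: Zadjoin_integral.
have Dz: theta * z = (a`_0)%:~R.
  by rewrite mulrBr Da (evZ_split0 Da1) mulrC addrC addKr.
suff Az: Zadjoin theta z.
  have -> : y = z - (0 - evZ a1) by rewrite sub0r opprK subrK.
  by apply: ZadjoinB => //; apply: ZadjoinB => //; apply: (Zadjoin_int 0).
have nz_theta: theta != 0.
  apply: contraNneq p'u => th0; have := evZ_split0 Dc.
  rewrite (eqP rootF) th0 mulr0 add0r => /esym/eqP.
  rewrite -(rmorph_int (in_alg L)) fmorph_eq0 intr_eq0 F0E mulf_eq0.
  by rewrite eqz_nat -[p == 0]negbK -lt0n prime_gt0 //= => /eqP->; rewrite dvdz0.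
have [p_a0 | p'a0] := boolP (p %| a`_0)%Z; last first.
  have [d dvd_d] := integral_quotient_root (ZKz.2) Dz.
  have: (p %| a`_0 ^+ d)%Z by apply: dvdz_trans dvd_d; rewrite F0E dvdz_mulr.
  rewrite dvdzE abszX Euclid_dvdX // => /andP[p_a0 _].
  by rewrite dvdzE p_a0 in p'a0.
have /dvdzP[k Dk] := p_a0.
(* Cancel [theta] in [theta (u z) = u p k = k F(0) = - k c(theta) theta]. *)
have Duz: u%:~R * z = (0 - k%:~R * evZ c).
  apply: (mulfI nz_theta); rewrite mulrCA Dz Dk.
  have := evZ_split0 Dc; rewrite (eqP rootF) F0E => /esym/eqP.
  rewrite addr_eq0 => /eqP Dct; rewrite sub0r mulrN.
  rewrite [theta * _]mulrCA [theta * _]mulrC Dct !intrM; ring.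
apply: (@Zadjoin_coprime u p) => //.
- by rewrite coprimez_sym coprimezE /= prime_coprime.
- rewrite Duz; apply: ZadjoinB; first exact: (Zadjoin_int 0).
  by apply: ZadjoinM; [apply: Zadjoin_int | exists c].
rewrite mulrBr; apply: ZadjoinB => //; apply: ZadjoinM => //; exact: Zadjoin_int.
Qed.

(** Powers of [theta] are removed one at a time: the induction hypothesis handles [theta y], then
    the single step handles [y]. *)
Lemma maximal_at_theta k y :
    ZK y -> Zadjoin theta (p%:R * y) -> Zadjoin theta (theta ^+ k * y) ->
  Zadjoin theta y.
Proof.
have ZKt: ZK theta by apply: Zadjoin_integral; apply: Zadjoin_root.
elim: k y => [|k IHk] y ZKy Apy; first by rewrite mul1r.
rewrite exprSr -mulrA => Aty.
apply: maximal_at_theta_step => //; apply: IHk => //; first exact: ZKM.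
by rewrite mulrCA; apply: ZadjoinM => //; apply: Zadjoin_root.
Qed.

End OneStep.

(** The conditions put [F] in the square of the ideal [(p, X)], so [Z[theta]] is singular at
    [(p, theta)]. *)
Lemma nonmaximal_at_theta e :
    (1 < e < size F)%N -> (forall i, (i < e)%N -> (p %| F`_i)%Z) ->
    ((p ^ 2)%N %| F`_0)%Z ->
  exists x, [/\ ZK x, ~ Zadjoin theta x & Zadjoin theta (x *+ p)].
Proof.
case: e => [|[|e]] //= lt_e p_F /dvdzP[c Dc].
have nzp: p%:R != 0 :> L.
  by rewrite -(rmorph_nat (in_alg L)) fmorph_eq0 pnatr_eq0 -lt0n prime_gt0.
(* The original exponent is now [e.+2], so the witness [theta^(e + 1) g(theta) / p] is
   [theta * T / p]. *)
pose g := drop_poly e.+2 F; pose T := theta ^+ e * evZ g.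
pose h := \poly_(i < e.+2) (F`_i %/ p)%Z.
have DF: F = p%:Z *: h + g * 'X^(e.+2).
  rewrite -{1}(poly_take_drop e.+2 F); congr (_ + _); apply/polyP=> i.
  rewrite coef_take_poly coefZ coef_poly; case: ltnP => [lt_i|]; last by rewrite mulr0.
  by rewrite mulrC divzK ?p_F.
have [h1 Dh] := poly_split0 h; pose H := evZ h1.
have Dh0: h`_0 = c * p.
  by rewrite coef_poly /= Dc -mulnn PoszM mulrA mulzK // eqz_nat -lt0n prime_gt0.
have rel: theta ^+ 2 * T = - (p%:R * (theta * H + p%:R * c%:~R)).
  apply/eqP; rewrite -addr_eq0 addrC; apply/eqP; move: (eqP rootF); rewrite {1}DF.
  rewrite rmorphD rmorphM /= map_polyZ /= map_polyXn hornerD hornerZ hornerM hornerXn.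
  rewrite (evZ_split0 Dh) Dh0 intrM -/H /T => <-; rewrite !exprS; ring.
pose alpha := theta * T / p%:R.
have ZT: Zadjoin theta T.
  by exists ('X^e * g); rewrite rmorphM /= map_polyXn hornerM hornerXn.
have Dpa: alpha *+ p = theta * T by rewrite -mulr_natr divfK.
have inA x : Zadjoin theta x -> integralOver (intr : int -> L) x.
  by case/Zadjoin_integral.
exists alpha; split; last by rewrite Dpa; apply: ZadjoinM => //; apply: Zadjoin_root.
- split.
    have /Zadjoin_integral[KtT _]: Zadjoin theta (theta * T).
      by apply: ZadjoinM => //; apply: Zadjoin_root.
    by rewrite rpredM // rpredV rpred_nat.
  (* By [rel], [p (alpha^2 + H alpha + c T) = T (theta alpha + theta H + p c) = 0]. *)
  apply: (@integral_root_monic _ _ _ _ ('X^2 + H *: 'X + (c%:~R * T)%:P)).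
  + rewrite -addrA monicE lead_coefDl ?lead_coefXn // size_polyXn.
    rewrite (leq_ltn_trans (size_polyD _ _)) // gtn_max.
    rewrite (leq_ltn_trans (size_scale_leq _ _)) ?size_polyX //.
    by rewrite (leq_ltn_trans (size_polyC_leq1 _)).
  + have Dta: theta * alpha = - (theta * H + p%:R * c%:~R).
      by rewrite /alpha mulrA [theta * (theta * T)]mulrA -expr2 rel mulNr [p%:R * _]mulrC mulfK.
    rewrite /root !(hornerD, hornerZ, hornerXn, hornerX, hornerC); apply/eqP/(mulfI nzp); rewrite mulr0.
    transitivity (alpha *+ p * alpha + H * (alpha *+ p) + p%:R * c%:~R * T).
      by rewrite -(mulr_natl alpha); ring.
    rewrite Dpa [_ * T * _]mulrAC Dta; ring.
  apply/integral_poly=> i; rewrite !coefD coefXn coefZ coefX coefC.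
  apply: integral_add; first apply: integral_add.
  + exact: integral_nat.
  + by apply: integral_mul; [apply: inA; exists h1 | apply: integral_nat].
  case: ifP => _; last exact: integral0.
  by apply: inA; apply: ZadjoinM => //; apply: Zadjoin_int.
(* Otherwise, comparing coordinates in the power basis, [p] would divide the monic polynomial
   [g * 'X^(e.+1)]. *)
case/Zadjoin_small=> q szq Dq; have szF: (0 < size F)%N by rewrite lt0n size_poly_eq0 monic_neq0.
have szg: size g = (size F - e.+2)%N by rewrite size_drop_poly.
have nzg: g != 0 by rewrite -size_poly_eq0 szg subn_eq0 -ltnNge.
have Dg: lead_coef g = 1.
  rewrite lead_coefE szg coef_drop_poly -(monicP monF) lead_coefE; congr _`_(_).
  by move: (size F) lt_e; lia.
have: g * 'X^(e.+1) = q *+ p.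
  apply: evZ_inj.
  - by rewrite size_mulXn // szg; move: (size F) lt_e; lia.
  - by rewrite -scaler_nat (leq_ltn_trans (size_scale_leq _ _)).
  rewrite rmorphMn hornerMn -Dq Dpa rmorphM /= map_polyXn hornerM hornerXn /T exprS; ring.
move/(congr1 lead_coef); rewrite lead_coefM lead_coefXn mulr1 Dg.
rewrite lead_coefE coefMn -mulr_natr natz => Dl.
have: (p %| 1)%Z by rewrite [X in (_ %| X)%Z]Dl dvdz_mull.
by rewrite dvdzE /= dvdn1 => /eqP Dp; have := prime_gt1 p_prime; rewrite Dp.
Qed.

End PrimeAtRootZero.
End MonicRoot.

(** * The truncated exponential *)

Lemma map_exp_poly n :
  map_poly (intr : int -> rat) (exp_poly n) = n`!%:R *: exp_trunc n.
Proof.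
apply/polyP=> i; rewrite coef_map coefZ !coef_poly /=; rewrite ltnS; case: leqP => [le_in|]; last first.
  by rewrite mulr0.
rewrite -[(_ %/ _)%N%:~R]/((_ %/ _)%N%:R) -{2}(divnK (dvdn_fact_fact le_in)) natrM mulfK //.
by rewrite pnatr_eq0 -lt0n fact_gt0.
Qed.

Lemma deriv_exp_poly n : (exp_poly n)^`() = exp_poly n - 'X^n.
Proof.
apply/polyP=> i; rewrite coef_deriv coefB coefXn !coef_poly !ltnS.
case: ltngtP => [lt_in|lt_ni|->]; rewrite ?mul0rn ?subr0 //.
  rewrite -mulr_natr natz -PoszM; congr Posz; apply/eqP.
  rewrite -(eqn_pmul2r (fact_gt0 i)) divnK ?dvdn_fact_fact // 1?ltnW //.
  by rewrite -mulnA -factS divnK ?dvdn_fact_fact.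
by rewrite divnn fact_gt0 subrr.
Qed.

Theorem theorem1p2 (n p : nat) (n_gt0 : (0 < n)%N) (p_prime : prime p)
    (L : fieldExtType rat) (theta : L)
    (theta_root : root (map_poly (in_alg L) (exp_trunc n)) theta) :
  exists2 N : nat,
    has_index (ring_of_integers <<1; theta>>%AS) (Zadjoin theta) N &
    (~~ (p %| N)%N <-> ~~ (p ^ 2 %| n`!)%N).
Proof.
pose F := exp_poly n; have monF : F \is monic := monic_exp_poly n.
have irrF := irreducible_exp_poly n_gt0; rewrite -/F in irrF.
have rootF: root (map_poly intr F) theta.
  rewrite /root -horner_pZtoQ map_exp_poly map_polyZ hornerZ.
  by rewrite (eqP theta_root) mulr0.
have F0: F`_0 = n`! by rewrite exp_poly_coef // fact0 divn1.
have conductor x : ring_of_integers <<1; theta>>%AS x -> Zadjoin theta (theta ^+ n * x).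
  move=> /(different_conductor monF irrF rootF); rewrite deriv_exp_poly.
  rewrite rmorphB /= map_polyXn hornerD hornerN hornerXn (eqP rootF) => Ax.
  have -> : theta ^+ n * x = 0 - (0 - theta ^+ n) * x by ring.
  by apply: ZadjoinB Ax; apply: (Zadjoin_int theta 0).
have denom x : ring_of_integers <<1; theta>>%AS x ->
    Zadjoin theta ((n`! ^ n)%N%:R * x).
  (* [F(theta) = 0] reads [n! = - c(theta) theta], so [theta^n] divides [n!^n] in [Z[theta]]. *)
  move=> /conductor Ax; have [c /(evZ_split0 theta) Dc] := poly_split0 F.
  move: Dc; rewrite (eqP rootF) F0 => /esym/eqP; rewrite addrC addr_eq0 => /eqP Dn.
  have -> : (n`! ^ n)%N%:R * x = (- (map_poly intr c).[theta]) ^+ n * (theta ^+ n * x).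
    by rewrite natrX -[n`!%:R]/(n`!%:~R) Dn mulrA -exprMn mulNr.
  apply: ZadjoinM => //; elim: (n) => [|k IHk]; first exact: (Zadjoin_int theta 1).
  by rewrite exprS; apply: ZadjoinM => //; exists (- c); rewrite rmorphN hornerN.
(* The factor 2 ensures a modulus above 1 even when [n = 1]. *)
have D_gt1: (1 < 2 * n`! ^ n)%N by have := expn_gt0 n`! n; rewrite fact_gt0 /=; lia.
have [|N idxN divN] := has_index_Zadjoin monF irrF rootF D_gt1.
  move=> x /denom Ax; rewrite natrM -mulrA; apply: ZadjoinM => //.
  exact: (Zadjoin_int theta 2).
exists N => //; have [div1 div2] := divN p p_prime; split; apply: contra.
  move=> p2_dvd; apply: div2.
  have q_gt0: (0 < n %/ p)%N.
    rewrite lt0n; apply: contraTneq p2_dvd => q0.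
    by rewrite pfactor_dvdn ?fact_gt0 // (logn_fact_div n p_prime) q0 fact0 logn1.
  have le_e: (p * (n %/ p) <= n)%N by rewrite mulnC leq_trunc_div.
  (* For [i < e], the product [n! / i!] contains the factor [e], a multiple of [p]; and
     [e >= p >= 2]. *)
  apply: (nonmaximal_at_theta monF irrF rootF p_prime (e := (p * (n %/ p))%N)).
  - by rewrite size_exp_poly ltnS le_e andbT (leq_trans (prime_gt1 p_prime)) ?leq_pmulr.
  - move=> i lt_i; have le_in := ltnW (leq_trans lt_i le_e).
    have := exp_poly_coef_neq0 n i; rewrite le_in exp_poly_coef // -absz_gt0 /= => c_gt0.
    rewrite dvdzE /= -[p in (p %| _)%N]expn1 (pfactor_dvdn 1 p_prime c_gt0).
    rewrite (logn_div p (dvdn_fact_fact le_in)) subn_gt0.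
    by rewrite (leq_trans (ltn_logn_fact p_prime lt_i)) // leq_logn_fact.
  - by rewrite F0.
move=> /div1[y [ZKy nAy]]; rewrite -mulr_natl => Apy.
(* If [p] does not divide [n!], it is prime to the denominator [n!^n] of [y]. *)
have [/dvdnP[u Du]|p'n] := boolP (p %| n`!)%N; last first.
  case: nAy; apply: (@Zadjoin_coprime _ theta p (n`! ^ n)%N) => //; last exact: denom.
  by rewrite coprimezE /= coprimeXr // prime_coprime.
apply: contraT => p2'n; case: nAy.
apply: (maximal_at_theta monF irrF rootF p_prime (u := u)) (conductor y ZKy) => //.
  by rewrite F0 Du mulnC PoszM.
by apply: contra p2'n; rewrite dvdzE /= Du expnSr => /dvdn_mul->.
Qed.
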